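(* Let $n\ge 2$, let $F$ be a field, $S=F[x_1,\dots,x_n]$ and $S'=F[x_2,\dots,x_n]$. Let $t\ge 0$ and let $M$ be a Gotzmann set of monomials in $S_t$. For each integer $i$ let $M^i$ be the set of monomials in $M$ divisible by $x_1^i$ but not by $x_1^{i+1}$ (empty if $i<0$ or $i>t$), and put $d_i=|M^i|$. Let $0\le i\le t+1$. If $d_i^{<n-2>}\ge d_{i-1}$, then $M^i/x_1$ is Gotzmann in $S'$. Moreover, if $d_i^{<n-2>}<d_{i-1}$, then either $(d_i+1)^{<n-2>}>d_{i-1}-1$ or $d_i+1>d_{i+1}^{<n-2>}$.
   Context: All variables have degree $1$, and $S_t$ is the homogeneous component of degree $t$. Monomials are ordered lexicographically with $x_1>\dots>x_n$. In a polynomial ring $A$ over $F$ in finitely many variables of degree $1$ (here $A=S$ or $A=S'$), a set $L$ of monomials of degree $s$ is lexsegment if whenever $m\in L$ and $v$ is a monomial of degree $s$ in $A$ with $v>m$, then $v\in L$. For a set $N$ of monomials of degree $s$ in $A$, $\operatorname{lex}_A(N)$ is the lexsegment set of $|N|$ monomials of degree $s$ in $A$, and $A_1\cdot N$ is the set of monomials $um$ with $u$ a variable of $A$ and $m\in N$. $N$ is Gotzmann in $A$ if $|A_1\cdot\operatorname{lex}_A(N)|=|A_1\cdot N|$. $M^i/x_1$ denotes the set of monomials $m$ in $S'$ such that $mx_1^i\in M^i$ (a set of monomials of degree $t-i$ in $S'$). For integers $k\ge 0$ and $d\ge 0$, $d^{<k>}$ is defined as follows. If $k\ge 1$, $d^{<k>}=|A_1\cdot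 L|$, where $A$ is a polynomial ring in $k+1$ variables and $L$ is a lexsegment set of $d$ monomials of some fixed degree in $A$ (by Macaulay this depends only on $d$ and $k$, not on the degree, as long as the degree is large enough for $L$ to exist). For $k=0$, $d^{<0>}=d$. In particular $0^{<k>}=0$. *)

(* Defs.v *)
From HB Require Import structures.
From mathcomp Require Import all_boot all_order all_algebra.
From mathcomp Require Import finmap.
From mathcomp.multinomials Require Import mpoly.

Set Implicit Arguments.
Unset Strict Implicit.
Unset Printing Implicit Defensive.

Import Order.TTheory.

Local Open Scope nat_scope.
Local Open Scope fset_scope.

(* A monomial of a polynomial ring in n variables is its exponent vector
   m : 'X_{1..n}, so [+%MM] is the product of monomials, [U_(i)%MM] is the
   i-th variable and [(_ <= _)%MM] is divisibility.  Indices start at 0: the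
   variable x_1 is U_(ord0). *)

Definition monoms (n s : nat) : {fset 'X_{1..n}} :=
  [fset bmnm b | b in {: 'X_{1..n < s.+1}} & mdeg (bmnm b) == s].

(* On monomials of equal degree, the order [<%O] of 'X_{1..n} is the
   lexicographic order with x_1 > ... > x_n (lemma [ltmcP] of mpoly). *)
Definition lexsegment (n s : nat) (L : {fset 'X_{1..n}}) : Prop :=
  L `<=` monoms n s /\
  forall m v : 'X_{1..n},
    m \in L -> v \in monoms n s -> (m < v)%O -> v \in L.

(* The d largest monomials of degree s (all of them if there are fewer
   than d). *)
Definition lexset (n s d : nat) : {fset 'X_{1..n}} :=
  [fset m | m in take d (sort (fun a b : 'X_{1..n} => (b <= a)%O)
                              (monoms n s))].

Definition mulvars (n : nat) (N : {fset 'X_{1..n}}) : {fset 'X_{1..n}} :=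
  [fset (U_(i) + m)%MM | i in {: 'I_n}, m in N].

(* Meant for sets N of monomials of degree s. *)
Definition gotzmann (n s : nat) (N : {fset 'X_{1..n}}) : Prop :=
  #|` mulvars (lexset n s #|` N|) | = #|` mulvars N |.

(* d^{<k>}.  For k >= 1 the degree d is large enough for a lexsegment set of
   d monomials in k+1 variables to exist; any other degree in which there is
   one gives the same value, see [anglepowE]. *)
Definition anglepow (d k : nat) : nat :=
  if k is 0 then d else #|` mulvars (lexset k.+1 d d) |.

(* M^i, the monomials of M in which x_1 has exponent exactly i. *)
Definition xslice (n : nat) (M : {fset 'X_{1..n.+1}}) (i : int) :
    {fset 'X_{1..n.+1}} :=
  match i with
  | Posz k => [fset m in M | (U_(ord0) *+ k <= m)%MM
                             && ~~ (U_(ord0) *+ k.+1 <= m)%MM]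
  | Negz _ => fset0
  end.

(* The inclusion of the monomials of F[x_2, ..., x_{n+1}] into those of
   F[x_1, ..., x_{n+1}]; the variable of index j of the former is x_{j+2}. *)
Definition mlift (n : nat) (m : 'X_{1..n}) : 'X_{1..n.+1} :=
  [multinom (if unlift ord0 j is Some k then m k else 0) | j < n.+1].

(* M^i / x_1, for M a set of monomials of degree t and i <= t + 1.  For
   i = t + 1 the truncated t - i is harmless, because M^i is empty. *)
Definition xquot (n t : nat) (M : {fset 'X_{1..n.+1}}) (i : nat) :
    {fset 'X_{1..n}} :=
  [fset m in monoms n (t - i) |
     (mlift m + U_(ord0) *+ i)%MM \in xslice M (Posz i)].

Lemma monomsE n s (m : 'X_{1..n}) : (m \in monoms n s) = (mdeg m == s).
Proof.
apply/imfsetP/idP => [[b /= + ->]|/eqP hm]; first by rewrite inE.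
have hb : mdeg m < s.+1 by rewrite hm.
by exists (BMultinom hb) => //=; rewrite inE /= hm eqxx.
Qed.

Lemma lexset_lexsegment n s d : lexsegment s (lexset n s d).
Proof.
set r := fun a b : 'X_{1..n} => (b <= a)%O.
have rtot : total r by move=> a b; exact: le_total.
have rtr : transitive r by move=> a b c ab bc; exact: le_trans bc ab.
set w := sort r (monoms n s).
have memw v : (v \in w) = (v \in monoms n s) by rewrite mem_sort.
have hin v : (v \in lexset n s d) = (v \in take d w).
  by rewrite /lexset; apply/imfsetP/idP => [[? ? ->]//|hv]; exists v.
split; first by apply/fsubsetP => v; rewrite hin => /mem_take; rewrite memw.
move=> m v; rewrite !hin -memw => hm hv mv.
rewrite -(cat_take_drop d w) mem_cat in hv; case/orP: hv => // hv.
have /= : sorted r (take d w ++ drop d w).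
  by rewrite cat_take_drop sort_sorted.
rewrite (sorted_pairwise rtr) pairwise_cat => /and3P[/allrelP/(_ m v hm hv)].
by rewrite /r leNgt mv.
Qed.

Lemma card_lexset n s d : d <= #|` monoms n s| -> #|` lexset n s d| = d.
Proof.
move=> hd; rewrite /lexset card_imfset //= undup_id.
  by rewrite size_take_min size_sort; apply/minn_idPl.
by apply: take_uniq; rewrite sort_uniq fset_uniq.
Qed.

Lemma lexsegment_eq n s (L1 L2 : {fset 'X_{1..n}}) :
  lexsegment s L1 -> lexsegment s L2 -> #|` L1| = #|` L2| -> L1 = L2.
Proof.
move=> [s1 h1] [s2 h2] hc.
suff sub : L1 `<=` L2 by apply/eqP; rewrite eqEfcard sub hc /=.
apply/fsubsetP => m m1; apply/negPn/negP => m2.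
have sub : L2 `<=` L1.
  apply/fsubsetP => v v2.
  case: (ltgtP m v) => [mv|vm|<- //].
    by apply: (h1 m) => //; exact: (fsubsetP s2).
  by move: m2; rewrite (h2 v) //; exact: (fsubsetP s1).
have /eqP e : L2 == L1 by rewrite eqEfcard sub hc /=.
by rewrite e m1 in m2.
Qed.

Definition mshift n (a : 'X_{1..n}) (L : {fset 'X_{1..n}}) :=
  [fset (a + m)%MM | m in L].

Lemma addmCA n (a b c : 'X_{1..n}) : (a + (b + c) = b + (a + c))%MM.
Proof. by rewrite !addmA (addmC a). Qed.

Lemma card_mshift n (a : 'X_{1..n}) L : #|` mshift a L| = #|` L|.
Proof.
rewrite /mshift card_imfset //= => m1 m2 /eqP.
by rewrite eqm_add2l => /eqP.
Qed.

Lemma mulvars_mshift n (a : 'X_{1..n}) L :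
  mulvars (mshift a L) = mshift a (mulvars L).
Proof.
apply/fsetP => v; apply/imfset2P/imfsetP => /=.
  move=> [i _ [_ /imfsetP[m /= mL ->] ->]]; exists (U_(i) + m)%MM.
    by apply/imfset2P; exists i => //; exists m.
  by rewrite addmCA.
move=> [_ /imfset2P[i _ [m /= mL ->]] ->]; exists i => //.
by exists (a + m)%MM; [apply/imfsetP; exists m | rewrite addmCA].
Qed.

Lemma lexsegment_mshift n s j (L : {fset 'X_{1..n.+1}}) :
  lexsegment s L -> lexsegment (j + s) (mshift (U_(ord0) *+ j)%MM L).
Proof.
set a := (U_(ord0) *+ j)%MM => -[sL hL].
have da : mdeg a = j by rewrite /a mdegMn mdeg1 mul1n.
have a0 : a ord0 = j by rewrite /a mulmnE mnm1E eqxx mul1n.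
have dm m : m \in L -> mdeg m = s.
  by move=> /(fsubsetP sL); rewrite monomsE => /eqP.
split.
  apply/fsubsetP => _ /imfsetP[m /= mL ->].
  by rewrite monomsE mdegD da (dm _ mL).
move=> _ v /imfsetP[m /= mL ->]; rewrite monomsE => /eqP dv lt.
have av : (a <= v)%MM.
  apply/mnm_lepP => k; rewrite /a mulmnE mnm1E.
  have [<-|//] := eqVneq; rewrite mul1n.
  have /(ltmcP _)[|p e lt'] := lt; first by rewrite mdegD da (dm _ mL) dv.
  have [p0|p0] := eqVneq p ord0.
    by move: lt'; rewrite p0 mnmDE a0 => /ltnW; apply: leq_trans; rewrite leq_addr.
  rewrite -(e ord0) ?mnmDE ?a0 ?leq_addr //=.
  by rewrite lt0n; apply: contraNneq p0 => p0; apply/eqP/val_inj.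
have ev : v = (a + (v - a))%MM by rewrite addmC submK.
apply/imfsetP; exists (v - a)%MM => //=; apply: (hL m) => //.
  rewrite monomsE; move: dv; rewrite {1}ev mdegD da => /addnI ->; exact: eqxx.
by move: lt; rewrite {1}ev ltmc_add2r.
Qed.

Lemma card_mulvars_lexsegment n s1 s2 (L1 L2 : {fset 'X_{1..n.+1}}) :
  lexsegment s1 L1 -> lexsegment s2 L2 -> #|` L1| = #|` L2| ->
  #|` mulvars L1| = #|` mulvars L2|.
Proof.
move=> h1 h2 hc; set a := (fun j => U_(ord0) *+ j)%MM : nat -> 'X_{1..n.+1}.
rewrite -(card_mshift (a s2) (mulvars L1)) -(card_mshift (a s1) (mulvars L2)).
rewrite -!mulvars_mshift (@lexsegment_eq _ (s2 + s1) (mshift (a s2) L1)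
  (mshift (a s1) L2)) ?card_mshift //; first exact: lexsegment_mshift.
by rewrite addnC; exact: lexsegment_mshift.
Qed.

Lemma leq_card_monoms k d : d <= #|` monoms k.+2 d|.
Proof.
pose f (c : 'I_d) : 'X_{1..k.+2} :=
  (U_(ord0) *+ c + U_(lift ord0 ord0) *+ (d - c))%MM.
have f_inj : injective f.
  move=> b c /(congr1 (fun m : 'X_{1..k.+2} => m ord0)).
  rewrite /f !mnmDE !mulmnE !mnm1E eqxx /= !mul1n !mul0n !addn0.
  exact: val_inj.
have cf : #|` [fset f c | c in {: 'I_d}] | = d.
  by rewrite card_imfset //= -cardE card_ord.
rewrite -[leqLHS]cf; apply: fsubset_leq_card.
apply/fsubsetP => _ /imfsetP[c _ ->].
by rewrite monomsE mdegD !mdegMn !mdeg1 !mul1n subnKC ?(ltnW (ltn_ord c)).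
Qed.

Lemma anglepowE s k (L : {fset 'X_{1..k.+2}}) :
  lexsegment s L -> anglepow #|` L| k.+1 = #|` mulvars L|.
Proof.
move=> hL; apply: card_mulvars_lexsegment hL _.
  exact: lexset_lexsegment.
exact/card_lexset/leq_card_monoms.
Qed.

(* Main.v *)
Require Import Defs.
From mathcomp Require Import all_boot all_order all_algebra.
From mathcomp Require Import finmap.
From mathcomp.multinomials Require Import mpoly.
From mathcomp Require Import zify.

Set Implicit Arguments.
Unset Strict Implicit.
Unset Printing Implicit Defensive.

Import Order.TTheory.

Local Open Scope fset_scope.
Local Open Scope nat_scope.

(** Write d_j for the number of monomials of M of x_1-degree j, and g for the
    Macaulay growth function d |-> d^{<n-2>} of S'.  The part of S_1 M of
    x_1-degree j is, with x_1^j divided out, the union of S'_1 times the j-th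
    slice of M and of the slice of index j - 1.  By Macaulay's theorem in S' it
    has at least max (g d_j, d_{j-1}) elements.  Piling up lexsegments of S' of
    sizes d_j attains this bound in every x_1-degree at once: S'_1 times a
    lexsegment is a lexsegment, and two lexsegments of the same degree are
    nested.  So [stackgrowth d], the sum of
    these maxima, is the growth of an actual set of monomials; by Macaulay's
    theorem in S it is at least the growth of the lexsegment of size |M|,
    which is |S_1 M| when M is Gotzmann.  Hence a Gotzmann set minimises
    [stackgrowth] among all admissible sequences of the same sum
    ([gotzmann_stack_min]), and attains the bound in each x_1-degree.

    Where g d_i >= d_{i-1}, the bound in x_1-degree i says that the i-th slice
    grows to g d_i, that is, the slice is Gotzmann ([gotzmann_slice]).  Where
    g d_i < d_{i-1} and both alternatives of the second claim fail, moving one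
    monomial from slice i - 1 to slice i lowers the i-th maximum by one and
    raises no other, contradicting minimality ([gotzmann_no_transfer]).

    Macaulay's theorem itself ([macaulay_lex]) is proved by induction on the
    number of variables.  For at least three variables, M is compressed with
    respect to every variable x_c: the slices of M by the powers of x_c are
    replaced with lexsegments, which does not increase the growth, by the
    induction hypothesis, and moves M up in the lexicographic order, so the
    process stops.  A set M that all compressions fix is strongly stable,
    because an exchange of x_a for x_b keeps the exponent of a third variable.
    For a strongly stable set, |S_1 M| is |M| plus the growth, in one variable
    fewer, of the part M_0 of M without the last variable
    ([card_mulvars_stable]).  Finally the lexsegment L of the same size has
    L_0 included in M_0 ([slice_lexset_sub]), so its growth is at most that of M.
    In one and two variables the theorem is checked directly. *)

(** * Inserting and deleting a variable *)

(** The monomial x_c^j v of the ring with the additional variable x_c. *)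
Definition mins n (c : 'I_n.+1) (j : nat) (v : 'X_{1..n}) : 'X_{1..n.+1} :=
  [multinom (if unlift c k is Some l then v l else j) | k < n.+1].

Definition mres n (c : 'I_n.+1) (m : 'X_{1..n.+1}) : 'X_{1..n} :=
  [multinom m (lift c k) | k < n].

Lemma mins_self n (c : 'I_n.+1) j (v : 'X_{1..n}) : mins c j v c = j.
Proof. by rewrite mnmE unlift_none. Qed.

Lemma mins_lift n (c : 'I_n.+1) j (v : 'X_{1..n}) k :
  mins c j v (lift c k) = v k.
Proof. by rewrite mnmE liftK. Qed.

Lemma mresE n (c : 'I_n.+1) (m : 'X_{1..n.+1}) k : mres c m k = m (lift c k).
Proof. exact: mnmE. Qed.

Lemma minsK n (c : 'I_n.+1) j : cancel (mins c j) (mres c).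
Proof. by move=> v; apply/mnmP => k; rewrite mresE mins_lift. Qed.

Lemma mresK n (c : 'I_n.+1) (m : 'X_{1..n.+1}) : mins c (m c) (mres c m) = m.
Proof.
apply/mnmP => k; case: (unliftP c k) => [l|] ->; last by rewrite mins_self.
by rewrite mins_lift mresE.
Qed.

Lemma mdeg_mins n (c : 'I_n.+1) j v : mdeg (mins c j v) = j + mdeg v.
Proof.
rewrite !mdegE (@bigD1_ord _ _ _ _ c) //= mins_self; congr (_ + _).
by apply: eq_bigr => k _; rewrite mins_lift.
Qed.

Lemma mdeg_mres n (c : 'I_n.+1) (m : 'X_{1..n.+1}) :
  m c + mdeg (mres c m) = mdeg m.
Proof. by rewrite -[in RHS](mresK c m) mdeg_mins. Qed.

Lemma ltn_lift n (c : 'I_n.+1) (p q : 'I_n) : (lift c p < lift c q) = (p < q).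
Proof. by rewrite /= /bump; lia. Qed.

(** Exponents of x_c that agree never decide a lexicographic comparison, so
    adding or removing them preserves the order, whatever the position of c. *)
Lemma ltmc_mins n (c : 'I_n.+1) j (u v : 'X_{1..n}) :
  mdeg u = mdeg v -> (mins c j u < mins c j v)%O = (u < v)%O.
Proof.
move=> duv; have duv' : mdeg (mins c j u) = mdeg (mins c j v).
  by rewrite !mdeg_mins duv.
apply/(ltmcP duv')/(ltmcP duv) => -[p].
  case: (unliftP c p) => [q|] -> e; last by rewrite !mins_self ltnn.
  rewrite !mins_lift => lt; exists q => // k kq.
  by rewrite -!(mins_lift c j); apply: e; rewrite ltn_lift.
move=> e lt; exists (lift c p); rewrite ?mins_lift // => k.
case: (unliftP c k) => [q|] ->; last by rewrite !mins_self.
by rewrite ltn_lift !mins_lift; exact: e.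
Qed.

Lemma ltmc_mres n (c : 'I_n.+1) (u v : 'X_{1..n.+1}) :
  mdeg u = mdeg v -> u c = v c -> (mres c u < mres c v)%O = (u < v)%O.
Proof.
move=> duv uvc; rewrite -[in RHS](mresK c u) -[in RHS](mresK c v) uvc.
rewrite ltmc_mins //; apply/eqP; rewrite -(eqn_add2l (v c)) mdeg_mres -uvc.
by rewrite mdeg_mres duv.
Qed.

Lemma mins_addU n (c : 'I_n.+1) j k v :
  mins c j (U_(k) + v)%MM = (U_(lift c k) + mins c j v)%MM.
Proof.
apply/mnmP => l; rewrite !mnmDE; case: (unliftP c l) => [q|] ->.
  by rewrite !mins_lift !mnmDE !mnm1E (inj_eq lift_inj).
by rewrite !mins_self mnm1E eq_sym (negbTE (neq_lift _ _)).
Qed.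

Lemma mins_succ n (c : 'I_n.+1) j v : mins c j.+1 v = (U_(c) + mins c j v)%MM.
Proof.
apply/mnmP => l; rewrite mnmDE mnm1E; case: (unliftP c l) => [q|] ->.
  by rewrite !mins_lift (negbTE (neq_lift _ _)).
by rewrite !mins_self eqxx.
Qed.

(** * Slices by the powers of a variable *)

Lemma mulvarsP n (N : {fset 'X_{1..n}}) v :
  reflect (exists i, exists2 m, m \in N & v = (U_(i) + m)%MM) (v \in mulvars N).
Proof.
apply: (iffP idP) => [/imfset2P[i _ [m mN ->]]|[i [m mN ->]]].
  by exists i, m.
by apply/imfset2P; exists i => //; exists m.
Qed.

Lemma mulvars_sub n (A B : {fset 'X_{1..n}}) :
  A `<=` B -> mulvars A `<=` mulvars B.
Proof.
move=> /fsubsetP sAB; apply/fsubsetP => v /mulvarsP[i [m mA ->]].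
by apply/mulvarsP; exists i, m => //; exact: sAB.
Qed.

Lemma mulvars_monoms n s (N : {fset 'X_{1..n}}) :
  N `<=` monoms n s -> mulvars N `<=` monoms n s.+1.
Proof.
move=> /fsubsetP hN; apply/fsubsetP => v /mulvarsP[i [m /hN + ->]].
by rewrite !monomsE mdegD mdeg1 => /eqP->.
Qed.

Lemma mulvars0 n : mulvars fset0 = fset0 :> {fset 'X_{1..n}}.
Proof.
by apply/fsetP => v; rewrite inE; apply/mulvarsP => -[i [m]]; rewrite inE.
Qed.

Definition slice n (c : 'I_n.+1) (M : {fset 'X_{1..n.+1}}) (j : nat) :
    {fset 'X_{1..n}} :=
  [fset mres c m | m in M & m c == j].

Lemma in_slice n (c : 'I_n.+1) M j v : (v \in slice c M j) = (mins c j v \in M).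
Proof.
apply/imfsetP/idP => [[m /= + ->]|h]; last first.
  by exists (mins c j v); rewrite ?minsK //= inE /= mins_self eqxx h.
by rewrite inE /= => /andP[mM /eqP<-]; rewrite mresK.
Qed.

Lemma slice_monoms n (c : 'I_n.+1) t M j :
  M `<=` monoms n.+1 t -> slice c M j `<=` monoms n (t - j).
Proof.
move=> /fsubsetP hM; apply/fsubsetP => v; rewrite in_slice => /hM.
by rewrite !monomsE mdeg_mins => /eqP<-; rewrite addKn.
Qed.

Lemma slice_oversize n (c : 'I_n.+1) t M j :
  M `<=` monoms n.+1 t -> t < j -> slice c M j = fset0.
Proof.
move=> /fsubsetP hM tj; apply/fsetP => v; rewrite in_slice inE.
by apply/negP => /hM; rewrite monomsE mdeg_mins; lia.
Qed.

(** The form with an arbitrary summand serves twice: with the constant 1 for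
    cardinals, and with the rank of a monomial for the termination of
    compression. *)
Lemma sum_slice n (c : 'I_n.+1) t (M : {fset 'X_{1..n.+1}})
    (f : 'X_{1..n.+1} -> nat) :
  M `<=` monoms n.+1 t ->
  \sum_(m <- M) f m = \sum_(j < t.+1) \sum_(v <- slice c M j) f (mins c j v).
Proof.
move=> /fsubsetP hM.
have -> : \sum_(m <- M) f m =
    \sum_(m <- M) \sum_(j < t.+1 | m c == j :> nat) f m.
  apply: eq_big_seq => m /hM; rewrite monomsE -(mdeg_mres c) => /eqP dm.
  have hm : m c < t.+1 by rewrite ltnS -dm leq_addr.
  by rewrite (big_pred1 (Ordinal hm)) // => j; rewrite eq_sym.
rewrite (exchange_big_dep predT) //=; apply: eq_bigr => j _.
rewrite big_imfset /=; last first.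
  move=> u v /andP[_ /eqP uj] /andP[_ /eqP vj] e.
  by rewrite -(mresK c u) -(mresK c v) uj vj e.
rewrite big_filter; apply: eq_bigr => m /eqP mj.
by rewrite -mj mresK.
Qed.

Lemma card_slice n (c : 'I_n.+1) t (M : {fset 'X_{1..n.+1}}) :
  M `<=` monoms n.+1 t -> #|` M| = \sum_(j < t.+1) #|` slice c M j|.
Proof.
move=> hM; rewrite card_fset_sum1 (sum_slice c _ hM).
by apply: eq_bigr => j _; rewrite card_fset_sum1.
Qed.

(** In the slices of S_1 M this shift accounts for the multiplication by x_c. *)
Definition prev (T : choiceType) (D : nat -> {fset T}) (j : nat) : {fset T} :=
  if j is k.+1 then D k else fset0.

(** The exponent of x_c in a product u m, u a variable, is that of m, unless u
    is x_c, when it is one more. *)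
Lemma slice_mulvars n (c : 'I_n.+1) (M : {fset 'X_{1..n.+1}}) j :
  slice c (mulvars M) j = mulvars (slice c M j) `|` prev (slice c M) j.
Proof.
apply/fsetP => v; rewrite in_slice inE; apply/mulvarsP/orP.
  move=> [i [m mM e]]; case: (unliftP c i) e => [k|] -> e.
    left; apply/mulvarsP; exists k, (mres c m); last first.
      apply: (can_inj (@minsK _ c j)); rewrite mins_addU e; congr (_ + _)%MM.
      have <- : m c = j; last by rewrite mresK.
      have := mins_self c j v; rewrite e mnmDE mnm1E.
      by rewrite eq_sym (negbTE (neq_lift _ _)).
    rewrite in_slice; have <- : m c = j; last by rewrite mresK.
    have := mins_self c j v; rewrite e mnmDE mnm1E.
    by rewrite eq_sym (negbTE (neq_lift _ _)).
  right; have := mins_self c j v; rewrite e mnmDE mnm1E eqxx add1n => ej.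
  rewrite -ej /= in_slice; rewrite -ej mins_succ in e.
  by move/eqP: e; rewrite eqm_add2l => /eqP->.
case=> [/mulvarsP[k [u]]|].
  rewrite in_slice => uM ->.
  by exists (lift c k), (mins c j u); rewrite ?mins_addU.
case: j => [|j]; rewrite ?inE //= in_slice => h.
by exists c, (mins c j v); rewrite ?mins_succ.
Qed.

Lemma card_mulvars n (c : 'I_n.+1) t (M : {fset 'X_{1..n.+1}}) :
  M `<=` monoms n.+1 t ->
  #|` mulvars M| =
    \sum_(j < t.+2) #|` mulvars (slice c M j) `|` prev (slice c M) j|.
Proof.
move=> hM; rewrite (card_slice c (mulvars_monoms hM)).
by apply: eq_bigr => j _; rewrite slice_mulvars.
Qed.

(** * Lexsegments *)

Lemma lexset_monoms n s d : lexset n s d `<=` monoms n s.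
Proof. by case: (lexset_lexsegment n s d). Qed.

Lemma lexset0 n s : lexset n s 0 = fset0.
Proof. by apply/eqP; rewrite -cardfs_eq0 card_lexset. Qed.

Lemma lexset_card n s (L : {fset 'X_{1..n}}) :
  lexsegment s L -> lexset n s #|` L| = L.
Proof.
move=> hL; apply: (lexsegment_eq (lexset_lexsegment _ _ _) hL).
by apply/card_lexset/fsubset_leq_card; case: hL.
Qed.

Lemma lexsegment_subset n s (A B : {fset 'X_{1..n}}) :
  lexsegment s A -> lexsegment s B -> #|` A| <= #|` B| -> A `<=` B.
Proof.
move=> hA hB cAB; have [/fsubsetP sA lA] := hA; have [/fsubsetP sB lB] := hB.
apply/fsubsetP => m mA; apply/negPn/negP => mB.
have sBA : B `<=` A.
  apply/fsubsetP => v vB; case: (ltgtP m v) => [mv|vm|<- //].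
    by apply: (lA m) => //; exact: sB.
  by case/negP: mB; apply: (lB v) => //; exact: sA.
have e : B = A by apply/eqP; rewrite eqEfcard sBA.
by rewrite e mA in mB.
Qed.

Lemma lem_mdeg_eq n (u w : 'X_{1..n}) :
  (w <= u)%MM -> mdeg w = mdeg u -> w = u.
Proof.
move=> wu e; have := congr1 (@mdeg n) (submK wu).
rewrite mdegD e => /eqP; rewrite -[X in _ == X]add0n eqn_add2r mdeg_eq0.
by move=> /eqP h; rewrite -(submK wu) h add0m.
Qed.

(** Let v > x_i u with u in L, and divide v by its last variable x_k.  Up to
    the first position p where v and x_i u differ, v / x_k is still at least
    u, the loss of one at k being made up by the strict inequality at p in
    the only case where it matters, k = p; so v / x_k >= u belongs to L. *)
Lemma lexsegment_mulvars n s (L : {fset 'X_{1..n}}) :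
  lexsegment s L -> lexsegment s.+1 (mulvars L).
Proof.
move=> [sL hL]; split; first exact: mulvars_monoms.
move=> m v /mulvarsP[i [u uL ->]]; rewrite monomsE => /eqP dv lt.
have du : mdeg u = s by have /(fsubsetP sL) := uL; rewrite monomsE => /eqP.
have dm : mdeg (U_(i) + u)%MM = mdeg v by rewrite mdegD mdeg1 du dv.
have /(ltmcP dm)[p e ltp] := lt.
have vp : 0 < v p by exact: leq_ltn_trans ltp.
have [k vk kmax] := @arg_maxnP _ p (fun k => 0 < v k) val vp.
have sub1 : (U_(k) <= v)%MM by rewrite lep1mP -lt0n.
have ev : (U_(k) + (v - U_(k)) = v)%MM by rewrite addmC submK.
apply/mulvarsP; exists k, (v - U_(k))%MM; last by rewrite ev.
set w := (v - U_(k))%MM in ev *.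
have dw : mdeg w = s by move: dv; rewrite -ev mdegD mdeg1 => -[].
have wM : w \in monoms n s by rewrite monomsE dw.
have we q : v q = (k == q) + w q by rewrite -ev mnmDE mnm1E.
case: (ltgtP u w) => [uw|wu|<- //]; first exact: hL uw.
have duw : mdeg w = mdeg u by rewrite dw du.
have /(ltmcP duw)[r er ltr] := wu.
have pk : p <= k by exact: kmax.
have ge (q : 'I_n) : q <= p -> u q <= w q.
  move=> qp; case: (ltngtP q p) qp => // [qp _|/val_inj-> _].
    have := e q qp; rewrite mnmDE we.
    have -> : (k == q) = false.
      by apply/negbTE/eqP => kq; rewrite -kq in qp; lia.
    by rewrite add0n => <-; rewrite leq_addl.
  by move: ltp; rewrite mnmDE we; case: (k == p) => /=; lia.
have pr : p < r by rewrite ltnNge; apply/negP => /ge; rewrite leqNgt ltr.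
have ekp : k = p.
  apply/eqP/negPn/negP => kp; have := er p pr.
  by move: ltp; rewrite mnmDE we (negbTE kp); lia.
(* Now w vanishes beyond k = p < r and agrees with u before r: w divides u. *)
suff wu' : w = u by rewrite wu' uL.
apply: lem_mdeg_eq => //; apply/mnm_lepP => q; rewrite leqNgt.
case: (ltnP q r) => [/er-> |rq]; first by rewrite ltnn.
have : ~~ (0 < v q).
  by apply/negP => vq; have := kmax q vq; rewrite ekp /=; lia.
by rewrite we; lia.
Qed.

(** * Stacks of lexsegments and compression *)

(** The sequences of sizes that the slices of a set of monomials of degree t
    can have. *)
Definition stackable n t (d : nat -> nat) : Prop :=
  forall j, d j <= if j <= t then #|` monoms n (t - j)| else 0.

Definition lexstack n (c : 'I_n.+1) t (d : nat -> nat) :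
    {fset 'X_{1..n.+1}} :=
  [fset m in monoms n.+1 t | mres c m \in lexset n (t - m c) (d (m c))].

Definition prevn (d : nat -> nat) (j : nat) : nat :=
  if j is k.+1 then d k else 0.

Definition stackgrowth n t (d : nat -> nat) : nat :=
  \sum_(j < t.+2) maxn #|` mulvars (lexset n (t - j) (d j))| (prevn d j).

Lemma in_lexstack n (c : 'I_n.+1) t d m : (m \in lexstack c t d) =
  (m \in monoms n.+1 t) && (mres c m \in lexset n (t - m c) (d (m c))).
Proof. by rewrite in_fset. Qed.

Lemma lexstack_monoms n (c : 'I_n.+1) t d : lexstack c t d `<=` monoms n.+1 t.
Proof. by apply/fsubsetP => m; rewrite in_lexstack => /andP[]. Qed.

Lemma stackable_oversize n t d j : stackable n t d -> t < j -> d j = 0.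
Proof.
by move=> hd tj; have := hd j; rewrite [j <= t]leqNgt tj leqn0 => /eqP.
Qed.

Lemma slice_lexstack n (c : 'I_n.+1) t d j : stackable n t d ->
  slice c (lexstack c t d) j = lexset n (t - j) (d j).
Proof.
move=> hd; case: (leqP j t) => jt.
  apply/fsetP => v; rewrite in_slice in_lexstack minsK mins_self monomsE mdeg_mins.
  apply/andP/idP => [[]//|h]; split=> //.
  have /fsubsetP/(_ v h) := lexset_monoms n (t - j) (d j).
  by rewrite monomsE => /eqP->; rewrite subnKC.
rewrite (slice_oversize _ (lexstack_monoms _ _ _)) //.
by rewrite (stackable_oversize hd) // lexset0.
Qed.

Lemma card_lexset_stackable n t d j : stackable n t d ->
  #|` lexset n (t - j) (d j)| = d j.
Proof.
move=> hd; case: (leqP j t) => jt; last first.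
  by rewrite (stackable_oversize hd) // lexset0.
by apply: card_lexset; have := hd j; rewrite jt.
Qed.

Lemma card_lexstack n (c : 'I_n.+1) t d : stackable n t d ->
  #|` lexstack c t d| = \sum_(j < t.+1) d j.
Proof.
move=> hd; rewrite (card_slice c (lexstack_monoms c t d)).
by apply: eq_bigr => j _; rewrite slice_lexstack // card_lexset_stackable.
Qed.

Lemma card_fsetU_nested (T : choiceType) (A B : {fset T}) :
  A `<=` B \/ B `<=` A -> #|` A `|` B| = maxn #|` A| #|` B|.
Proof.
case=> h; have := fsubset_leq_card h.
  by move/fsetUidPr: h => -> /maxn_idPr.
by move/fsetUidPl: h => -> /maxn_idPl.
Qed.

(** In each x_c-degree two lexsegments of the same degree of the smaller ring
    are united; they are nested, so the larger one is the union. *)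
Lemma card_mulvars_lexstack n (c : 'I_n.+1) t d : stackable n t d ->
  #|` mulvars (lexstack c t d)| = stackgrowth n t d.
Proof.
move=> hd; rewrite (card_mulvars c (lexstack_monoms c t d)).
apply: eq_bigr => -[[|k] /= hj] _; rewrite !slice_lexstack //.
  by rewrite fsetU0 maxn0.
rewrite -[X in maxn _ X](card_lexset_stackable k hd); apply: card_fsetU_nested.
case: (leqP k.+1 t) => kt; last first.
  by left; rewrite (stackable_oversize hd) // lexset0 mulvars0 fsub0set.
have h1 := lexsegment_mulvars (lexset_lexsegment n (t - k.+1) (d k.+1)).
rewrite subnSK // in h1; have h2 := lexset_lexsegment n (t - k) (d k).
case: (leqP #|` mulvars (lexset n (t - k.+1) (d k.+1))|
            #|` lexset n (t - k) (d k)|).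
  by left; exact: lexsegment_subset h1 h2 _.
by move/ltnW; right; exact: lexsegment_subset h2 h1 _.
Qed.

Definition slicesize n (c : 'I_n.+1) (M : {fset 'X_{1..n.+1}}) (j : nat) :
    nat :=
  #|` slice c M j|.

Lemma stackable_slicesize n (c : 'I_n.+1) t M : M `<=` monoms n.+1 t ->
  stackable n t (slicesize c M).
Proof.
move=> hM j; rewrite /slicesize; case: (leqP j t) => jt.
  exact/fsubset_leq_card/slice_monoms.
by rewrite (slice_oversize _ hM).
Qed.

(** Macaulay's theorem in n variables, stated as a property of n because it is
    proved by induction on n. *)
Definition macaulay n : Prop := forall s (N : {fset 'X_{1..n}}),
  N `<=` monoms n s -> #|` mulvars (lexset n s #|` N|)| <= #|` mulvars N|.

Lemma slice_growth n (c : 'I_n.+1) t M j : macaulay n -> M `<=` monoms n.+1 t ->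
  maxn #|` mulvars (lexset n (t - j) (slicesize c M j))|
       (prevn (slicesize c M) j)
    <= #|` mulvars (slice c M j) `|` prev (slice c M) j|.
Proof.
move=> mac hM; rewrite geq_max; apply/andP; split.
  apply: leq_trans (mac _ _ (slice_monoms c j hM)) _.
  exact/fsubset_leq_card/fsubsetUl.
case: j => //= j; exact/fsubset_leq_card/fsubsetUr.
Qed.

Lemma stackgrowth_slicesize n (c : 'I_n.+1) t M :
  macaulay n -> M `<=` monoms n.+1 t ->
  stackgrowth n t (slicesize c M) <= #|` mulvars M|.
Proof.
move=> mac hM; rewrite (card_mulvars c hM); apply: leq_sum => j _.
exact: slice_growth.
Qed.

Definition compress n (c : 'I_n.+1) t M := lexstack c t (slicesize c M).

Lemma card_compress n (c : 'I_n.+1) t M : M `<=` monoms n.+1 t ->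
  #|` compress c t M| = #|` M|.
Proof.
move=> hM; rewrite (card_slice c hM) card_lexstack //.
exact: stackable_slicesize.
Qed.

Lemma card_mulvars_compress n (c : 'I_n.+1) t M :
  macaulay n -> M `<=` monoms n.+1 t ->
  #|` mulvars (compress c t M)| <= #|` mulvars M|.
Proof.
move=> mac hM; rewrite card_mulvars_lexstack; last exact: stackable_slicesize.
exact: stackgrowth_slicesize.
Qed.

(** Each element of L outside N is greater than each element of N outside L,
    and there are equally many of both, L being the lexsegment of size |N|. *)
Lemma lex_sum n s (N : {fset 'X_{1..n}}) (r : 'X_{1..n} -> nat) :
  N `<=` monoms n s ->
  {in monoms n s &, forall u v, (u < v)%O -> r v < r u} ->
  \sum_(v <- lexset n s #|` N|) r v <= \sum_(v <- N) r v
    ?= iff (lexset n s #|` N| == N).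
Proof.
move=> hN hr; set L := lexset n s #|` N|.
have cLN : #|` L| = #|` N| by rewrite card_lexset ?fsubset_leq_card.
have [sL hL] := lexset_lexsegment n s #|` N|; rewrite -/L in sL hL.
apply/leqifP; case: eqP => [->//|/eqP neq].
have cD : #|` L `\` N| = #|` N `\` L| by rewrite !cardfsD cLN fsetIC.
have pos : 0 < #|` N `\` L|.
  rewrite cardfs_gt0; apply: contra neq; rewrite fsetD_eq0 => sNL.
  by rewrite eq_sym eqEfcard sNL cLN leqnn.
have split (A B : {fset 'X_{1..n}}) :
    \sum_(v <- A) r v = \sum_(v <- A `&` B) r v + \sum_(v <- A `\` B) r v.
  rewrite (big_fsetID _ (mem B)) /=; congr (_ + _).
    by apply: eq_fbigl => v; rewrite !inE.
  by apply: eq_fbigl => v; rewrite !inE andbC.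
rewrite (split L N) (split N L) [N `&` L]fsetIC ltn_add2l.
have const (A : {fset 'X_{1..n}}) k : \sum_(v <- A) k = #|` A| * k.
  by rewrite card_fset_sum1 big_distrl /=; apply: eq_bigr => *; rewrite mul1n.
have below a b : a \in L `\` N -> b \in N `\` L -> r a < r b.
  rewrite !in_fsetD => /andP[aN aL] /andP[bL bN].
  have aM := fsubsetP sL a aL; have bM := fsubsetP hN b bN.
  apply: hr => //; case: (ltgtP a b) => [ab|//|ab].
    by case/negP: bL; exact: hL ab.
  by rewrite ab bN in aN.
have : \sum_(a <- L `\` N) #|` N `\` L| * (r a).+1
    <= \sum_(a <- L `\` N) \sum_(b <- N `\` L) r b.
  rewrite big_seq [leqRHS]big_seq; apply: leq_sum => a aA.
  by rewrite -const big_seq [leqRHS]big_seq; apply: leq_sum => b; exact: below.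
rewrite -big_distrr const cD /= leq_pmul2l //; apply: leq_trans.
rewrite -cD card_fset_sum1 in pos.
under [leqRHS]eq_bigr => a _ do rewrite -addn1.
by rewrite big_split -[ltnLHS]addn0 ltn_add2l.
Qed.

(** This is how the statement that the slices by powers of x_c are
    lexsegments reads without leaving the ring. *)
Definition lexslices n (c : 'I_n.+1) t (M : {fset 'X_{1..n.+1}}) : Prop :=
  forall m v : 'X_{1..n.+1}, m \in M -> v \in monoms n.+1 t ->
    v c = m c -> (m < v)%O -> v \in M.

(** The sum of the ranks decreases under compression, which is why repeated
    compression terminates. *)
Definition rank n t (m : 'X_{1..n}) : nat :=
  #|` [fset v in monoms n t | (m < v)%O]|.

Definition weight n t (M : {fset 'X_{1..n}}) : nat := \sum_(m <- M) rank t m.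

(** Known as strongly stable sets, or Borel sets. *)
Definition stable n (M : {fset 'X_{1..n}}) : Prop :=
  forall (m : 'X_{1..n}) (a b : 'I_n), m \in M -> 0 < m a -> b < a ->
    (U_(b) + (m - U_(a)))%MM \in M.

Lemma lexslices_compress n (c : 'I_n.+1) t M : lexslices c t (compress c t M).
Proof.
move=> m v; rewrite !in_lexstack => /andP[mM hm] vM e lt; rewrite vM e /=.
have [_ hL] := lexset_lexsegment n (t - m c) (slicesize c M (m c)).
move: mM vM; rewrite !monomsE => /eqP dm /eqP dv.
apply: hL hm _ _; first by rewrite monomsE -dv -(mdeg_mres c) e addKn.
by rewrite ltmc_mres // dm dv.
Qed.

Lemma rank_lt n t :
  {in monoms n t &, forall u v, (u < v)%O -> rank t v < rank t u}.
Proof.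
move=> u v uM vM uv; apply: fproper_ltn_card.
rewrite fproperE; apply/andP; split.
  apply/fsubsetP => w; rewrite !in_fset /= !inE => /andP[-> /=].
  exact: lt_trans.
apply/negP => /fsubsetP/(_ v).
by rewrite !in_fset /= !inE ltxx uv vM => /(_ isT).
Qed.

Lemma weight_compress n (c : 'I_n.+1) t M : M `<=` monoms n.+1 t ->
  compress c t M != M -> weight t (compress c t M) < weight t M.
Proof.
move=> hM neq; rewrite /weight !(sum_slice c (t := t)) ?lexstack_monoms //.
have hs := stackable_slicesize c hM.
have le (j : 'I_t.+1) : true ->
    \sum_(v <- slice c (compress c t M) j) rank t (mins c j v) <=
    \sum_(v <- slice c M j) rank t (mins c j v)
      ?= iff (slice c (compress c t M) j == slice c M j).
  move=> _; rewrite slice_lexstack //; apply: lex_sum; first exact: slice_monoms.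
  have jt : j <= t by rewrite -ltnS.
  move=> u v; rewrite !monomsE => /eqP du /eqP dv uv.
  by apply: rank_lt; rewrite ?ltmc_mins ?monomsE ?mdeg_mins ?du ?dv ?subnKC.
rewrite (ltn_leqif (leqif_sum le)); apply: contra neq => /forallP h.
apply/eqP/fsetP => m; have [mt|mt] := leqP (m c) t; last first.
  have no A : A `<=` monoms n.+1 t -> (m \in A) = false.
    move=> /fsubsetP hA; apply/negP => /hA; rewrite monomsE -(mdeg_mres c).
    by move=> /eqP; lia.
  by rewrite !no ?lexstack_monoms.
rewrite -(mresK c m) -!in_slice.
by have /eqP -> := h (Ordinal (mt : m c < t.+1)).
Qed.

(** * Strongly stable sets *)

Lemma mdeg_exchange n (m : 'X_{1..n}) (a b : 'I_n) : 0 < m a ->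
  mdeg (U_(b) + (m - U_(a)))%MM = mdeg m.
Proof.
move=> ma; have sub1 : (U_(a) <= m)%MM by rewrite lep1mP -lt0n.
by rewrite -[in RHS](submK sub1) !mdegD !mdeg1 addnC.
Qed.

Lemma exchangeE n (m : 'X_{1..n}) (a b k : 'I_n) :
  (U_(b) + (m - U_(a)))%MM k = (b == k) + (m k - (a == k)).
Proof. by rewrite mnmDE mnmBE !mnm1E. Qed.

Lemma ltmc_exchange n (m : 'X_{1..n}) (a b : 'I_n) : 0 < m a -> b < a ->
  (m < (U_(b) + (m - U_(a)))%MM)%O.
Proof.
move=> ma ba; apply/ltmcP; first by rewrite mdeg_exchange.
have ab : (a == b) = false by apply/negP => /eqP ab; rewrite ab ltnn in ba.
exists b => [k kb|]; rewrite exchangeE; last by rewrite eqxx ab subn0.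
have -> : (b == k) = false by apply/negP => /eqP e; rewrite e ltnn in kb.
have -> : (a == k) = false by apply/negP => /eqP e; rewrite -e in kb; lia.
by rewrite subn0.
Qed.

Lemma lexsegment_stable n s (L : {fset 'X_{1..n}}) : lexsegment s L -> stable L.
Proof.
move=> [/fsubsetP sL hL] m a b mL ma ba; apply: (hL m) => //.
  by have := sL m mL; rewrite !monomsE mdeg_exchange.
exact: ltmc_exchange.
Qed.

(** The exchange of x_a for x_b is a move up inside the slices of any third
    variable: this is where three variables are needed. *)
Lemma lexslices_stable n t (M : {fset 'X_{1..n.+3}}) : M `<=` monoms n.+3 t ->
  (forall c, lexslices c t M) -> stable M.
Proof.
move=> /fsubsetP hM hc m a b mM ma ba.
have [c ca cb] : exists2 c : 'I_n.+3, c != a & c != b.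
  have : 0 < #|~: [set a; b]|.
    by rewrite cardsCs setCK card_ord cards2; case: (a != b).
  by move=> /card_gt0P[c]; rewrite !inE negb_or => /andP[ca cb]; exists c.
apply: (hc c m) => //; last exact: ltmc_exchange.
  by have := hM m mM; rewrite !monomsE mdeg_exchange.
by rewrite exchangeE eq_sym (negbTE cb) eq_sym (negbTE ca) subn0.
Qed.

(** In positive degree of the last variable, stability makes the multiples of
    a slice by the other variables fall into the preceding slice.  So these
    parts of S_1 M are the slices of M, and only the part of degree 0 is
    new. *)
Lemma card_mulvars_stable n t (M : {fset 'X_{1..n.+1}}) :
  M `<=` monoms n.+1 t -> stable M ->
  #|` mulvars M| = #|` mulvars (slice ord_max M 0)| + #|` M|.
Proof.
move=> hM st; rewrite (card_mulvars ord_max hM) big_ord_recl /= fsetU0.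
congr (_ + _); rewrite (card_slice ord_max hM); apply: eq_bigr => j _.
congr #|` _|; apply/fsetUidPr/fsubsetP => _ /mulvarsP[k [u + ->]].
rewrite /bump /= add1n !in_slice mins_succ mins_addU => h.
have := st _ ord_max (lift ord_max k) h.
rewrite [(U_(ord_max) + _)%MM]addmC addmK; apply.
  by rewrite mnmDE mnm1E eqxx addn1.
by have := ltn_ord k; rewrite /= /bump; lia.
Qed.

(** Suppose that u in L is free of the last variable and not in M.  Replacing
    the last variable by its predecessor, one factor at a time, leads from any
    v in M to an element of M free of the last variable, which exceeds u
    because the part of M free of that variable is a lexsegment.  The first
    difference to u then occurs before both variables involved, so v itself
    exceeds u.  Thus M is included in L, hence equal to L, although u is in L
    only. *)
Lemma slice_lexset_sub n t (M : {fset 'X_{1..n.+2}}) :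
  M `<=` monoms n.+2 t -> stable M -> lexslices ord_max t M ->
  slice ord_max (lexset n.+2 t #|` M|) 0 `<=` slice ord_max M 0.
Proof.
move=> hM st hlex; set L := lexset n.+2 t #|` M|.
have [/fsubsetP sL hL] := lexset_lexsegment n.+2 t #|` M|.
apply/fsubsetP => u'; rewrite !in_slice; set u := mins _ _ _ => uL.
have u0 : u ord_max = 0 by rewrite mins_self.
apply/negPn/negP => uM.
have /eqP du : mdeg u == t by rewrite -monomsE; exact: sL.
have dM m : m \in M -> mdeg m = t.
  by move=> /(fsubsetP hM); rewrite monomsE => /eqP.
have below j (v : 'X_{1..n.+2}) : v ord_max = j -> v \in M -> (u < v)%O.
  elim: j v => [|j IHj] v vj vM.
    case: (ltgtP u v) => [//|vu|uv]; last by rewrite uv vM in uM.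
    by case/negP: uM; apply: hlex vM _ _ vu; rewrite ?monomsE ?du // vj.
  pose q : 'I_n.+2 := inord n.
  have qE : q = n :> nat by rewrite inordK.
  have q1 : q < (ord_max : 'I_n.+2) by rewrite qE /=.
  have qm : (q == ord_max) = false by apply/negbTE; rewrite neq_ltn q1.
  have vpos : 0 < v ord_max by rewrite vj.
  have wM := st _ _ _ vM vpos q1; set w := (_ + _)%MM in wM.
  have wE k : w k = (q == k) + (v k - (ord_max == k)) by rewrite exchangeE.
  have wj : w ord_max = j by rewrite wE qm eqxx vj subn1.
  have duw : mdeg u = mdeg w by rewrite du dM.
  have /(ltmcP duw)[p e lt] := IHj w wj wM.
  (* Otherwise u and w agree before the last two variables, and since u is
     free of the last one, u would divide w, of the same degree. *)
  have pq : p < q.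
    rewrite ltnNge; apply/negP => qp.
    suff uw : u = w by rewrite uw ltnn in lt.
    apply: lem_mdeg_eq => //; apply/mnm_lepP => k.
    case: (ltngtP k p) => [/e->//|pk|/val_inj->]; last exact: ltnW.
    suff -> : k = ord_max by rewrite u0.
    by apply/val_inj => /=; have := ltn_ord k; lia.
  apply/ltmcP; first by rewrite du dM.
  have neq (k : 'I_n.+2) : k <= p -> w k = v k.
    move=> kp; rewrite wE.
    have -> : (q == k) = false by apply/negP => /eqP h; rewrite h in pq; lia.
    have -> : (ord_max == k) = false.
      by apply/negP => /eqP h; rewrite -h in kp; lia.
    by rewrite subn0.
  exists p => [k kp|]; last by rewrite -neq.
  by rewrite e // neq // ltnW.
have sML : M `<=` L.
  apply/fsubsetP => v vM; apply: hL uL _ _; first exact: (fsubsetP hM).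
  exact: below vM.
have eML : M = L.
  apply/eqP; rewrite eqEfcard sML card_lexset //; exact: fsubset_leq_card.
by rewrite eML uL in uM.
Qed.

(** * Macaulay's theorem *)

Lemma mulvars1 (N : {fset 'X_{1..1}}) : #|` mulvars N| = #|` N|.
Proof.
rewrite -[RHS](card_mshift U_(ord0)%MM); congr #|` _|.
apply/fsetP => v; apply/mulvarsP/imfsetP => [[i [m mN ->]]|[m mN ->]].
  by exists m; rewrite ?(ord1 i).
by exists ord0, m.
Qed.

Lemma macaulay1 : macaulay 1.
Proof.
by move=> s N hN; rewrite !mulvars1 card_lexset //; exact: fsubset_leq_card.
Qed.

Lemma card_monoms1 s : #|` monoms 1 s| <= 1.
Proof.
suff /fsubset_leq_card : monoms 1 s `<=` [fset (U_(ord0) *+ s)%MM].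
  by rewrite cardfs1.
apply/fsubsetP => v; rewrite monomsE in_fset1 => /eqP<-; apply/eqP/mnmP => k.
by rewrite mulmnE mnm1E mdegE big_ord1 (ord1 k) mul1n.
Qed.

(** A nonempty set M in two variables grows by at least one: x_1 u, with u in M
    of largest x_1-degree, is not in x_2 M.  A lexsegment grows by at most one,
    its part free of x_2 being contained in the single power of x_1. *)
Lemma macaulay2 : macaulay 2.
Proof.
move=> t M hM; have [->|[m0 m0M]] := fset_0Vmem M.
  by rewrite lexset0 mulvars0.
have hL := lexset_lexsegment 2 t #|` M|.
have cL : #|` lexset 2 t #|` M| | = #|` M|.
  by rewrite card_lexset ?fsubset_leq_card.
rewrite (card_mulvars_stable hL.1) ?cL; last exact: lexsegment_stable hL.
rewrite mulvars1; apply: (@leq_trans #|` M|.+1).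
  rewrite -[leqRHS]add1n leq_add2r; apply: leq_trans (card_monoms1 t).
  by rewrite -[t in monoms 1 t]subn0; exact/fsubset_leq_card/slice_monoms/hL.1.
have [m _ mmax] := @arg_maxnP _ [` m0M] xpredT
  (fun m => (val m : 'X_{1..2}) ord0) isT.
have mM := valP m; set u := val m in mM mmax.
rewrite -(card_mshift U_(ord_max)%MM) -[leqLHS]add1n.
have out : (U_(ord0) + u)%MM \notin mshift U_(ord_max) M.
  apply/negP => /imfsetP[v /= vM e].
  have := congr1 (fun w : 'X_{1..2} => w ord0) e.
  by rewrite /= !mnmDE !mnm1E /=; have /= := mmax [` vM] isT; rewrite /=; lia.
apply: (@leq_trans #|` (U_(ord0) + u)%MM |` mshift U_(ord_max) M|).
  by rewrite cardfsU1 out.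
apply: fsubset_leq_card.
apply/fsubsetP => v; rewrite in_fset1U => /orP[/eqP->|/imfsetP[w /= wM ->]].
  by apply/mulvarsP; exists ord0, u.
by apply/mulvarsP; exists ord_max, w.
Qed.

Lemma macaulay_step n : macaulay n.+2 -> macaulay n.+3.
Proof.
move=> mac t M; have [k] := ubnP (weight t M).
elim: k M => // k IHk M; rewrite ltnS => wk hM.
case: (boolP [forall c, compress c t M == M]) => [/forallP fixM|].
  have hlex c : lexslices c t M.
    by rewrite -(eqP (fixM c)); exact: lexslices_compress.
  have st := lexslices_stable hM hlex.
  have hL := lexset_lexsegment n.+3 t #|` M|.
  rewrite (card_mulvars_stable hM st).
  rewrite (card_mulvars_stable hL.1); last exact: lexsegment_stable hL.
  rewrite card_lexset ?fsubset_leq_card // leq_add2r.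
  by apply/fsubset_leq_card/mulvars_sub/slice_lexset_sub.
rewrite negb_forall => /existsP[c neq].
rewrite -(card_compress c hM).
apply: leq_trans (card_mulvars_compress c mac hM).
apply: IHk; last exact: lexstack_monoms.
exact: leq_trans (weight_compress hM neq) wk.
Qed.

Theorem macaulay_lex n : macaulay n.+1.
Proof.
case: n => [|n]; first exact: macaulay1.
by elim: n => [|n IHn]; [exact: macaulay2 | exact: macaulay_step].
Qed.

(** * Minimality of Gotzmann sets *)

Lemma anglepow_lexset n s d : d <= #|` monoms n.+1 s| ->
  #|` mulvars (lexset n.+1 s d)| = anglepow d n.
Proof.
move=> hd; case: n hd => [|n] hd; first by rewrite mulvars1 card_lexset.
by rewrite -(anglepowE (lexset_lexsegment _ s d)) card_lexset.
Qed.

Lemma anglepow_leq n a b : a <= b -> anglepow a n <= anglepow b n.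
Proof.
case: n => [//|n] ab.
have hb := leq_card_monoms n b; have ha := leq_trans ab hb.
rewrite -(anglepow_lexset ha) -(anglepow_lexset hb).
apply/fsubset_leq_card/mulvars_sub.
apply: lexsegment_subset; try exact: lexset_lexsegment.
by rewrite !card_lexset.
Qed.

Lemma anglepow0 n : anglepow 0 n = 0.
Proof. by rewrite -(@anglepow_lexset n 0) // lexset0 mulvars0. Qed.

Lemma anglepow_stackable n t d j : stackable n.+1 t d ->
  #|` mulvars (lexset n.+1 (t - j) (d j))| = anglepow (d j) n.
Proof.
move=> hd; have := hd j; case: (leqP j t) => jt; first exact: anglepow_lexset.
by rewrite leqn0 => /eqP->; rewrite lexset0 mulvars0 anglepow0.
Qed.

Lemma anglepow_monoms n s :
  anglepow #|` monoms n.+1 s| n = #|` monoms n.+1 s.+1|.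
Proof.
rewrite -(@anglepow_lexset n s) // lexset_card; last by split.
suff -> : mulvars (monoms n.+1 s) = monoms n.+1 s.+1 by [].
apply/eqP; rewrite eqEfsubset mulvars_monoms //=.
apply/fsubsetP => v; rewrite monomsE => /eqP dv.
case: (pickP (fun i => v i != 0)) => [i vi|v0]; last first.
  suff v00 : v = 0%MM by rewrite v00 mdeg0 in dv.
  by apply/mnmP => k; rewrite mnm0E; apply/eqP/negPn; rewrite v0.
have ev : (U_(i) + (v - U_(i)) = v)%MM by rewrite addmC submK // lep1mP.
apply/mulvarsP; exists i, (v - U_(i))%MM => //.
by rewrite monomsE; move: dv; rewrite -[in mdeg v]ev mdegD mdeg1 add1n => -[->].
Qed.

Lemma gotzmann_stack_min n t (M : {fset 'X_{1..n.+2}}) d :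
  M `<=` monoms n.+2 t -> gotzmann t M -> stackable n.+1 t d ->
  \sum_(j < t.+1) d j = #|` M| ->
  #|` mulvars M| <= stackgrowth n.+1 t d.
Proof.
move=> hM gM hd sd; rewrite -gM -sd -(card_lexstack ord0 hd).
rewrite -(card_mulvars_lexstack ord0 hd); apply: macaulay_lex.
exact: lexstack_monoms.
Qed.

Lemma sum_indicator k m : k < m -> \sum_(j < m) (j == k :> nat) = 1.
Proof.
move=> km; rewrite (bigD1 (Ordinal km)) //= eqxx big1 // => j.
by rewrite -val_eqE => /negbTE /= ->.
Qed.

Lemma in_xslice n (M : {fset 'X_{1..n.+1}}) (k : nat) m :
  (m \in xslice M k) = (m \in M) && (m ord0 == k).
Proof.
rewrite in_fset /= inE; congr (_ && _).
have le j : (U_(ord0) *+ j <= m)%MM = (j <= m ord0).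
  apply/mnm_lepP/idP => [/(_ ord0)|h i]; rewrite mulmnE mnm1E ?eqxx ?mul1n //.
  by case: eqP => [<-|//]; rewrite mul1n.
by rewrite !le -leqNgt eqn_leq andbC.
Qed.

Lemma card_xslice n (M : {fset 'X_{1..n.+1}}) (k : nat) :
  #|` xslice M k| = slicesize ord0 M k.
Proof.
rewrite /slicesize.
have -> : slice ord0 M k = [fset mres ord0 m | m in xslice M k].
  apply/fsetP => v; apply/imfsetP/imfsetP => -[m /= hm ->]; exists m => //.
    by rewrite in_xslice.
  by rewrite in_xslice in hm.
rewrite [RHS]card_in_imfset //= => u v.
rewrite !in_xslice => /andP[_ /eqP uk] /andP[_ /eqP vk] e.
by rewrite -(mresK ord0 u) -(mresK ord0 v) uk vk e.
Qed.

Lemma mlift_mins n i (m : 'X_{1..n}) :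
  (mlift m + U_(ord0) *+ i)%MM = mins ord0 i m.
Proof.
apply/mnmP => k; rewrite mnmDE mulmnE mnm1E !mnmE.
case: unliftP => [l|] ->; last by rewrite eqxx mul1n.
by rewrite (negbTE (neq_lift _ _)) addn0.
Qed.

Lemma xquot_slice n t (M : {fset 'X_{1..n.+1}}) i :
  M `<=` monoms n.+1 t -> xquot t M i = slice ord0 M i.
Proof.
move=> hM; apply/fsetP => v; rewrite in_fset /= inE mlift_mins in_xslice.
rewrite mins_self eqxx andbT in_slice andb_idl // -in_slice.
exact/fsubsetP/slice_monoms.
Qed.

Lemma gotzmann_slice n t (M : {fset 'X_{1..n.+2}}) i :
  M `<=` monoms n.+2 t -> gotzmann t M -> i <= t.+1 ->
  prevn (slicesize ord0 M) i <= anglepow (slicesize ord0 M i) n ->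
  gotzmann (t - i) (slice ord0 M i).
Proof.
move=> hM gM hi hle.
have hs := stackable_slicesize ord0 hM.
have le (j : 'I_t.+2) (_ : true) :=
  leqif_eq (slice_growth ord0 j (@macaulay_lex n) hM).
have : stackgrowth n.+1 t (slicesize ord0 M) == #|` mulvars M|.
  rewrite eqn_leq stackgrowth_slicesize //; last exact: macaulay_lex.
  by apply: gotzmann_stack_min => //; rewrite (card_slice ord0 hM).
rewrite (card_mulvars ord0 hM) (leqif_sum le).
move=> /forallP/(_ (Ordinal (hi : i < t.+2))).
rewrite /= anglepow_stackable // (maxn_idPl hle) => /eqP e.
apply/eqP; rewrite eqn_leq macaulay_lex ?slice_monoms //=.
rewrite -/(slicesize ord0 M i) anglepow_stackable // e.
exact/fsubset_leq_card/fsubsetUl.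
Qed.

(** Moving one monomial from slice k to slice k + 1 leaves the sum of the sizes
    unchanged.  The term of index k + 1 of the growth drops by one, because
    d k exceeds both values of the growth function there; the term of index
    k + 2 does not see the change, and the term of index k can only drop. *)
Lemma gotzmann_no_transfer n t (M : {fset 'X_{1..n.+2}}) k
    (d := slicesize ord0 M) :
  M `<=` monoms n.+2 t -> gotzmann t M -> k < t ->
  anglepow (d k.+1).+1 n < d k ->
  (d k.+1).+1 <= anglepow (d k.+2) n -> False.
Proof.
move=> hM gM kt lt1 lt2.
have lt0 : anglepow (d k.+1) n < d k.
  exact: leq_ltn_trans (anglepow_leq n (leqnSn _)) lt1.
have hd : stackable n.+1 t d := stackable_slicesize ord0 hM.
pose d' j :=
  if j == k.+1 then (d k.+1).+1 else if j == k then (d k).-1 else d j.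
have hd' : stackable n.+1 t d'.
  move=> j; rewrite /d'; case: (j =P k.+1) => [->|_]; last first.
    case: (j =P k) => [->|_]; last exact: hd.
    exact: leq_trans (leq_pred _) (hd k).
  (* Slice k + 1 has room: a full slice would grow to all monomials of its
     degree plus one, so to at least d k. *)
  have := hd k.+1; rewrite kt leq_eqVlt => /orP[/eqP e|//].
  have := hd k; rewrite (ltnW kt) leqNgt => /negP[].
  by rewrite -subnSK // -anglepow_monoms -e.
have sd' : \sum_(j < t.+1) d' j = #|` M|.
  rewrite (card_slice ord0 hM); apply/eqP.
  (* Indicator functions spare isolating the two modified terms. *)
  rewrite -(eqn_add2r (\sum_(j < t.+1) (j == k :> nat))) -big_split /=.
  rewrite [X in _ == _ + X]sum_indicator; last lia.
  rewrite -(@sum_indicator k.+1 t.+1) // -big_split /=.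
  apply/eqP/eq_bigr => j _; rewrite /d' -/(slicesize ord0 M j) -/d.
  case: (j =P k.+1 :> nat) => [->|_]; first by lia.
  by case: (j =P k :> nat) => [->|_]; lia.
have := gotzmann_stack_min hM gM hd' sd'; rewrite leqNgt => /negP[].
apply: leq_trans (stackgrowth_slicesize ord0 (@macaulay_lex n) hM).
(* The drop by one is charged to the term of index k + 1. *)
rewrite -/d -addn1 -(@sum_indicator k.+1 t.+2); last lia.
rewrite -big_split /=; apply: leq_sum => j _.
rewrite !anglepow_stackable //; case: j => j /= _.
have d'k1 : d' k.+1 = (d k.+1).+1 by rewrite /d' eqxx.
have d'k : d' k = (d k).-1 by rewrite /d' ltn_eqF // eqxx.
have d'_out l : l != k.+1 -> l != k -> d' l = d l.
  by rewrite /d' => /negbTE-> /negbTE->.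
case: (eqVneq j k.+1) => [->|jk1]; first by rewrite /= d'k1 d'k; lia.
case: (eqVneq j k.+2) => [->|jk2]; first by rewrite /= d'k1 d'_out; lia.
have -> : prevn d' j = prevn d j by case: j jk1 jk2 => //= l *; exact: d'_out.
case: (eqVneq j k) => [->|jk]; last by rewrite d'_out // addn0.
by rewrite d'k; have := anglepow_leq n (leq_pred (d k)); lia.
Qed.

Theorem theorem6 (n : nat) (F : fieldType) (t : nat)
    (M : {fset 'X_{1..n.+2}}) (hM : M `<=` monoms n.+2 t)
    (gM : gotzmann t M) (i : nat) (hi : i <= t.+1) :
  let d := fun j : int => #|` xslice M j| in
  (d (i%:Z - 1)%R <= anglepow (d i) n -> gotzmann (t - i) (xquot t M i)) /\
  (anglepow (d i) n < d (i%:Z - 1)%R ->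
     d (i%:Z - 1)%R - 1 < anglepow (d i + 1) n \/
     anglepow (d (i%:Z + 1)%R) n < d i + 1).
Proof.
move=> d.
have dE k : d (Posz k) = slicesize ord0 M k by exact: card_xslice.
have dpred : d (i%:Z - 1)%R = prevn (slicesize ord0 M) i.
  case: (i) => [|k]; first exact: cardfs0.
  by rewrite /prevn -dE -addn1 PoszD GRing.addrK.
have dsucc : d (i%:Z + 1)%R = slicesize ord0 M i.+1 by rewrite -dE -addn1 PoszD.
rewrite dpred dsucc !dE xquot_slice //; split; first exact: gotzmann_slice.
case: i hi dpred dsucc => [//|k] hk _ _ /= lt.
set a := slicesize _ _ k.+1 in lt *; set b := slicesize _ _ k in lt *.
case: (ltnP (b - 1) (anglepow (a + 1) n)) => [|h1]; first by left.
case: (ltnP (anglepow (slicesize ord0 M k.+2) n) (a + 1)) => [|h2].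
  by right.
(* For k = t the slice of index k + 2 is empty, so h2 fails. *)
exfalso; have kt : k < t.
  rewrite ltnNge; apply/negP => tk; move: h2; rewrite /slicesize.
  by rewrite (slice_oversize _ hM) ?cardfs0 ?anglepow0; lia.
apply: (gotzmann_no_transfer hM gM kt); rewrite -?addn1 //.
by move: h1 lt; rewrite -/a -/b; lia.
Qed.
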